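(* Let $F:=\{x\in[0,1]: K'(x)=+\infty \text{ or } K'(x)=-\infty\}$. The Lebesgue measure of $F$ is $0$, while the Hausdorff dimension of $F$ is $1$.
   Context: Okamoto's functions. For $0<a<1$, define $F_a:[0,1]\to[0,1]$ as follows. Let $f_0(x)=x$ and, inductively for $n=0,1,2,\dots$, let $f_{n+1}$ be the unique continuous function on $[0,1]$ which is linear on each interval $[j/3^{n+1},(j+1)/3^{n+1}]$ ($j=0,\dots,3^{n+1}-1$) and satisfies, for $k=0,1,\dots,3^n-1$, $$f_{n+1}(k/3^n)=f_n(k/3^n),\qquad f_{n+1}((k+1)/3^n)=f_n((k+1)/3^n),$$ $$f_{n+1}((3k+1)/3^{n+1})=f_n(k/3^n)+a\,[f_n((k+1)/3^n)-f_n(k/3^n)],$$ $$f_{n+1}((3k+2)/3^{n+1})=f_n(k/3^n)+(1-a)\,[f_n((k+1)/3^n)-f_n(k/3^n)].$$ The sequence $(f_n)$ converges uniformly on $[0,1]$, and $F_a:=\lim_{n\to\infty}f_n$. In particular $F_{1/3}(x)=x$. For each fixed $x\in[0,1]$ the function $a\mapsto F_a(x)$ is differentiable on $(0,1)$. The function $K:[0,1]\to\mathbb{R}$ is defined by $$K(x):=\left.\frac{\partial F_a(x)}{\partial a}\right|_{a=1/3}.$$ $K'(x)=+\infty$ (resp. $-\infty$) means that $\lim_{h\to0}\frac{K(x+h)-K(x)}{h}=+\infty$ (resp. $-\infty$); at the endpoints $x=0$ and $x=1$ the limit is taken over $h$ with $x+h\in[0,1]$ (one-sided). *)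

(* Defs.v *)
From HB Require Import structures.
From mathcomp Require Import all_boot all_order all_algebra.
From mathcomp Require Import all_classical all_reals all_analysis.
From mathcomp Require Import ring lra.

Set Implicit Arguments.
Unset Strict Implicit.
Unset Printing Implicit Defensive.

Import Order.TTheory GRing.Theory Num.Theory.
Import numFieldNormedType.Exports.

Local Open Scope classical_set_scope.
Local Open Scope ring_scope.

Section Okamoto.
Context {R : realType}.
Implicit Types (a x : R) (n m j k : nat) (g v : R -> R).

(* The continuous function on [0, +oo[ taking the value [v j] at [j / m] and
   linear on each [j / m, (j + 1) / m]; see [grid_interpE]. *)
Definition grid_interp m (v : nat -> R) x : R :=
  let j := Num.truncn (m%:R * x) in
  v j + (m%:R * x - j%:R) * (v j.+1 - v j).

(* The value prescribed for f_(n+1) at j / 3^(n+1), where g = f_n. *)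
Definition okamoto_node a n g j : R :=
  let k := (j %/ 3)%N in
  let p := g (k%:R / 3 ^+ n) in
  let q := g (k.+1%:R / 3 ^+ n) in
  match (j %% 3)%N with
  | 0 => p
  | 1 => p + a * (q - p)
  | _ => p + (1 - a) * (q - p)
  end.

Fixpoint okamoto_approx a n : R -> R :=
  match n with
  | 0 => id
  | n'.+1 => grid_interp (3 ^ n) (okamoto_node a n' (okamoto_approx a n'))
  end.

Definition okamoto a x : R := limn (fun n => okamoto_approx a n x).

Definition okamotoK x : R := derive1 (fun a => okamoto a x) (1 / 3).

Lemma grid_interpE m (v : nat -> R) j x : (0 < m)%N ->
  j%:R / m%:R <= x <= j.+1%:R / m%:R ->
  grid_interp m v x = v j + (m%:R * x - j%:R) * (v j.+1 - v j).
Proof.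
move=> m0; have m0' : 0 < m%:R :> R by rewrite ltr0n.
rewrite ler_pdivrMr// ler_pdivlMr// ![x * _]mulrC => /andP[jx].
rewrite /grid_interp le_eqVlt => /predU1P[->|xj].
  by rewrite natrK -natr1; ring.
have jE : Num.truncn (m%:R * x) = j by apply: truncn_def; rewrite jx xj.
by rewrite jE.
Qed.

Lemma grid_interp_node m (v : nat -> R) j : (0 < m)%N ->
  grid_interp m v (j%:R / m%:R) = v j.
Proof.
move=> m0; have m0' : m%:R != 0 :> R by rewrite pnatr_eq0 -lt0n.
by rewrite /grid_interp mulrC divfK// natrK subrr mul0r addr0.
Qed.

Lemma okamoto_approx_node a n k :
  let f := okamoto_approx a in
  let p := f n (k%:R / 3 ^+ n) in
  let q := f n (k.+1%:R / 3 ^+ n) in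
  [/\ f n.+1 (k%:R / 3 ^+ n) = p,
      f n.+1 (k.+1%:R / 3 ^+ n) = q,
      f n.+1 ((3 * k + 1)%:R / 3 ^+ n.+1) = p + a * (q - p) &
      f n.+1 ((3 * k + 2)%:R / 3 ^+ n.+1) = p + (1 - a) * (q - p)].
Proof.
move=> f p q.
have E j : f n.+1 (j%:R / 3 ^+ n.+1) = okamoto_node a n (f n) j.
  by rewrite -natrX; apply: grid_interp_node; rewrite expn_gt0.
have E3 i : f n.+1 (i%:R / 3 ^+ n) = f n (i%:R / 3 ^+ n).
  have -> : i%:R / 3 ^+ n = (i * 3)%:R / 3 ^+ n.+1 :> R.
    by rewrite natrM exprS; field; rewrite expf_neq0 ?pnatr_eq0.
  by rewrite {1}E /okamoto_node modnMl mulnK// natrM exprS; congr (f n _);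
    field; rewrite expf_neq0 ?pnatr_eq0.
rewrite !E3; split=> //; rewrite E /okamoto_node [(3 * k)%N]mulnC.
- by rewrite modnMDl divnMDl// addn0.
- by rewrite modnMDl divnMDl// addn0.
Qed.

End Okamoto.

Section InfiniteDerivative.
Context {R : realType}.
Implicit Types (f : R -> R) (x : R).

(* Increments h are restricted to x + h in [0, 1], so that the limit is
   one-sided at 0 and 1 and values of f outside [0, 1] play no role. *)
Definition increments01 x : set_system R :=
  within [set h | 0 <= x + h <= 1] 0^'.

Definition derivative_pinfty f x : Prop :=
  (f (x + h) - f x) / h @[h --> increments01 x] --> +oo.

Definition derivative_ninfty f x : Prop :=
  (f (x + h) - f x) / h @[h --> increments01 x] --> -oo.

Definition infinite_derivative_set f : set R :=
  [set x | 0 <= x <= 1 /\ (derivative_pinfty f x \/ derivative_ninfty f x)].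

End InfiniteDerivative.

Section HausdorffDimension.
Context {R : realType}.
Implicit Types (A U : set R) (s delta : R).
Local Open Scope ereal_scope.

(* This is -oo on the empty set, which [diam_pow] treats separately. *)
Definition diam U : \bar R :=
  ereal_sup [set `|x - y|%:E | x in U & y in U].

(* The empty set contributes 0 also for s = 0, whereas 0 `^ 0 = 1. *)
Definition diam_pow s U : \bar R :=
  if U == set0 then 0 else diam U `^ s.

Definition delta_cover delta A : set (nat -> set R) :=
  [set U | A `<=` \bigcup_i U i /\ forall i, diam (U i) <= delta%:E].

Definition hausdorff_premeasure s delta A : \bar R :=
  ereal_inf [set \sum_(0 <= i <oo) diam_pow s (U i) | U in delta_cover delta A].

Definition hausdorff_measure s A : \bar R :=
  ereal_sup [set hausdorff_premeasure s delta A
            | delta in [set delta | (0 < delta)%R]].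

Definition hausdorff_dim A : \bar R :=
  ereal_inf [set s%:E | s in [set s | (0 <= s)%R /\ hausdorff_measure s A = 0]].

End HausdorffDimension.

(* Main.v *)
Require Import Defs.
From HB Require Import structures.
From mathcomp Require Import all_boot all_order all_algebra.
From mathcomp Require Import all_classical all_reals all_analysis.
From mathcomp Require Import ring lra zify.

Set Implicit Arguments.
Unset Strict Implicit.
Unset Printing Implicit Defensive.

Import Order.TTheory GRing.Theory Num.Theory.
Import numFieldNormedType.Exports.

Local Open Scope classical_set_scope.
Local Open Scope ring_scope.

(** Write F_a for Okamoto's function. Its graph is self-affine: for d = 0, 1, 2
    and t in [0, 1], F_a((d + t)/3) = c_d(a) + r_d(a) F_a(t), where the ratios
    r_d are a, 1 - 2a, a. Differentiating in a at 1/3, where F_a is the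
    identity, gives a Takagi type equation
      K((d + t)/3) = c'_d + w_d t + K(t)/3   with w = (1, -2, 1).
    The differentiation is justified by comparing F_a with its first-order
    expansion: the error satisfies the same self-affinity up to a term of order
    (a - 1/3)^2, hence is itself of that order ([takagi_error]).

    Iterating the equation, K on a triadic cell of order n is an affine function
    of slope 3 W_n plus a copy of K scaled by 3^(-n), where W_n is the sum of
    the w_d over the n digits of the cell ([okamotoK_cell]). Since K(0) = K(1),
    the mean slope of K over the cell is exactly 3 W_n, so an infinite
    derivative at x forces W_n(x) to tend to +oo or to -oo. As
    w_0 + w_1 + w_2 = 0, W_n is a random walk with centered bounded steps under
    Lebesgue measure. Stopped when it leaves the nonnegative numbers, it is a
    martingale bounded below, so by Markov's inequality it stays above a level L
    with probability O(1/L), and almost no point has W_n(x) tending to +oo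
    ([walk_pinfty_null]). This gives measure 0, and hence dimension at most 1,
    because a Lebesgue null set is null for the one-dimensional Hausdorff
    measure.

    For the lower bound, code a real y in [0, 1) by cutting its ternary
    expansion into blocks of m digits and replacing each block by one of m + 4
    digits whose walk is positive. This is possible because the three words
    obtained from a block by adding 0, 1 or 2 to all its digits have walks of
    sum 0, so one of them is nonnegative; four more digits among 0 and 2 make
    the walk positive, record which of the three was taken, and keep the coded
    point away from the endpoints of its cells. Then W_n tends to +oo along the
    code, and the distance to the cell endpoints upgrades this to
    K' = +oo ([nested_cells_derivative]). The inverse of the coding is Hölder
    continuous of every exponent s <= m / (m + 4) and onto [0, 1), so the
    s-dimensional Hausdorff measure of the set is not 0
    ([expanding_hausdorff_measure_neq0]); let m tend to infinity. *)

(** * Self-affinity of the approximants *)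

Section SelfAffinity.
Context {R : realType}.
Implicit Types (a x t : R) (n k j d : nat).

(** The value of the first approximant at d / 3; consecutive differences are
    the contraction ratios a, 1 - 2a and a. *)
Definition okamoto_break a d : R :=
  match d with 0 => 0 | 1 => a | 2 => 1 - a | _ => 1 end.

Lemma pow3_neq0 n : 3 ^+ n != 0 :> R.
Proof. by rewrite expf_neq0// pnatr_eq0. Qed.

Lemma pow3_gt0 n : 0 < 3 ^+ n :> R.
Proof. by rewrite exprn_gt0. Qed.

Lemma nat3E n : (3 ^ n)%:R = 3 ^+ n :> R.
Proof. by rewrite natrX. Qed.

Lemma approx_node_rec a n j :
  okamoto_approx a n.+1 (j%:R / 3 ^+ n.+1) =
  okamoto_approx a n ((j %/ 3)%:R / 3 ^+ n) + okamoto_break a (j %% 3) *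
    (okamoto_approx a n ((j %/ 3).+1%:R / 3 ^+ n) -
     okamoto_approx a n ((j %/ 3)%:R / 3 ^+ n)).
Proof.
rewrite -nat3E /= grid_interp_node ?expn_gt0// /okamoto_node.
have : (j %% 3 < 3)%N by rewrite ltn_mod.
by case: (j %% 3)%N => [|[|[|]]]// _ /=; rewrite mul0r addr0.
Qed.

(** The approximants are refined at the last ternary digit, while self-affinity
    concerns the first one; the two operations commute. *)
Lemma approx_node_affine a n d k : (d < 3)%N -> (k <= 3 ^ n)%N ->
  okamoto_approx a n.+1 ((d * 3 ^ n + k)%:R / 3 ^+ n.+1) =
  okamoto_break a d + (okamoto_break a d.+1 - okamoto_break a d) *
    okamoto_approx a n (k%:R / 3 ^+ n).
Proof.
move=> d3; elim: n k => [|n IHn] k kn.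
  rewrite approx_node_rec /= expr0 !divr1 expn0 muln1.
  by case: k kn => [|[|]]// _; case: d d3 => [|[|[|]]]//= _;
    rewrite ?addn0 ?addn1 ?divnn ?divn_small //=; ring.
rewrite approx_node_rec.
have E : (d * 3 ^ n.+1 + k = d * 3 ^ n * 3 + k)%N by rewrite expnS; ring.
rewrite E modnMDl divnMDl// IHn; last first.
  by rewrite -(mulnK (3 ^ n) (isT : (0 < 3)%N)) leq_div2r// -expnSr.
rewrite [in RHS]approx_node_rec -addnS.
have [kn'|kn'] := ltnP k (3 ^ n.+1).
  rewrite IHn; last by rewrite ltn_divLR// -expnSr.
  by ring.
have -> : k = (3 ^ n * 3)%N by apply/eqP; rewrite -expnSr; lia.
by rewrite modnMl /=; ring.
Qed.

Lemma triadic_cellP n t : 0 <= t <= 1 ->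
  exists2 k, (k < 3 ^ n)%N & k%:R / 3 ^+ n <= t <= k.+1%:R / 3 ^+ n.
Proof.
move=> /andP[t0 t1]; have [->|tn1] := eqVneq t 1.
  exists (3 ^ n).-1; first by rewrite prednK// expn_gt0.
  by rewrite prednK ?expn_gt0// ler_pdivrMr ?pow3_gt0// mul1r nat3E
    divff ?pow3_neq0// lexx andbT -nat3E ler_nat leq_pred.
have := truncn_itv (mulr_ge0 (ltW (pow3_gt0 n)) t0) => /andP[h1 h2].
exists (Num.truncn (3 ^+ n * t)).
  rewrite -(ltr_nat R) nat3E (le_lt_trans h1)//.
  by rewrite -[ltRHS]mulr1 ltr_pM2l ?pow3_gt0// lt_neqAle tn1.
by rewrite ler_pdivrMr ?pow3_gt0// ler_pdivlMr ?pow3_gt0// ![t * _]mulrC h1 ltW.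
Qed.

Lemma approx_interp a n k t : k%:R / 3 ^+ n <= t <= k.+1%:R / 3 ^+ n ->
  okamoto_approx a n t = okamoto_approx a n (k%:R / 3 ^+ n) +
   (3 ^+ n * t - k%:R) * (okamoto_approx a n (k.+1%:R / 3 ^+ n) -
      okamoto_approx a n (k%:R / 3 ^+ n)).
Proof.
case: n => [|n] h; first by rewrite /= expr0 !divr1 mul1r -natr1; ring.
have h3 : (0 < 3 ^ n.+1)%N by rewrite expn_gt0.
by rewrite -!nat3E in h *; rewrite /= !grid_interp_node// (grid_interpE _ h3 h).
Qed.

(** Both sides are affine on each cell of order n, and they agree at the
    nodes. *)
Lemma approx_affine a n d t : (d < 3)%N -> 0 <= t <= 1 ->
  okamoto_approx a n.+1 ((d%:R + t) / 3) =
  okamoto_break a d + (okamoto_break a d.+1 - okamoto_break a d) *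
    okamoto_approx a n t.
Proof.
move=> d3 t01; have [k kn kt] := triadic_cellP n t01.
have p3 := pow3_neq0 n; have p3' := pow3_gt0 n.
rewrite (approx_interp a kt).
rewrite (@approx_interp a n.+1 (d * 3 ^ n + k)); last first.
  move: kt; rewrite ler_pdivrMr// ler_pdivlMr// => /andP[h1 h2].
  rewrite [_ / _ <= _]ler_pdivrMr ?pow3_gt0//.
  rewrite [_ <= _ / 3 ^+ _]ler_pdivlMr ?pow3_gt0//.
  rewrite -addnS !natrD !natrM !nat3E exprS.
  have -> : (d%:R + t) / 3 * (3 * 3 ^+ n) = d%:R * 3 ^+ n + t * 3 ^+ n by field.
  by rewrite !lerD2l h1 h2.
rewrite -addnS !approx_node_affine ?(ltnW kn)//.
rewrite natrD natrM nat3E exprS.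
by field.
Qed.

Lemma ternary_cellP t : 0 <= t <= 1 ->
  exists2 d, (d < 3)%N & exists2 u, 0 <= u <= 1 & t = (d%:R + u) / 3 :> R.
Proof.
move=> t01; have [d d3 /andP[]] := triadic_cellP 1 t01.
rewrite expr1 ler_pdivrMr// ler_pdivlMr// -natr1 => h1 h2; exists d => //.
exists (3 * t - d%:R); last by field.
by apply/andP; split; lra.
Qed.

End SelfAffinity.

(** * Differentiation in the parameter at 1/3 *)

Section Derivative.
Context {R : realType}.
Implicit Types (a x t q B M : R) (n k j d : nat).

Lemma geometric_increments_cvg (u : R^nat) B q : 0 <= q < 1 -> 0 <= B ->
  (forall n, `|u n.+1 - u n| <= B * q ^+ n) -> cvgn u.
Proof.
move=> /andP[q0 q1] B0 uBq.
have -> : u = (fun n => u 0%N + series (telescope u) n).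
  by apply/funext => n; rewrite -eq_sum_telescope.
apply: is_cvgD; first exact: is_cvg_cst.
apply: normed_cvg; apply: (@series_le_cvg _ _ (geometric B q)) => //.
- by move=> n /=.
- by move=> n; rewrite /geometric/= mulr_ge0// exprn_ge0.
- by apply: is_cvg_geometric_series; rewrite ger0_norm.
Qed.

Lemma cvg_normr_le (u : R^nat) M : cvgn u -> (forall n, `|u n| <= M) ->
  `|limn u| <= M.
Proof.
move=> uc uM; rewrite ler_norml; apply/andP; split.
  by apply: limr_ge => //; near=> n; have := uM n; rewrite ler_norml => /andP[].
by apply: limr_le => //; near=> n; have := uM n; rewrite ler_norml => /andP[].
Unshelve. all: by end_near.
Qed.

(** The supremum S of |e| satisfies S <= q S + B. *)
Lemma contracted_bound (e : R -> R) q B M : 0 <= q < 1 ->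
  (forall t, 0 <= t <= 1 -> `|e t| <= M) ->
  (forall x, 0 <= x <= 1 ->
    exists2 t, 0 <= t <= 1 & `|e x| <= q * `|e t| + B) ->
  forall x, 0 <= x <= 1 -> `|e x| <= B / (1 - q).
Proof.
move=> /andP[q0 q1] eM eqB.
pose E := [set `|e t| | t in [set t | 0 <= t <= 1]].
have E0 : E !=set0 by exists `|e 0|; exists 0 => //=; rewrite lexx ler01.
have Eub : has_ubound E by exists M => _ [t t01 <-]; exact: eM.
have supE : sup E <= q * sup E + B.
  apply: ge_sup => // _ [x x01 <-]; have [t t01 ext] := eqB _ x01.
  by rewrite (le_trans ext)// lerD2r ler_wpM2l// ub_le_sup//; exists t.
move=> x x01; apply: (@le_trans _ _ (sup E)).
  by apply: ub_le_sup => //; exists x.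
by rewrite ler_pdivlMr ?subr_gt0//; lra.
Qed.

(** The radius 1/12 keeps the three contraction ratios at most 1/2. *)
Definition near_third a := `|a - 1 / 3| <= 1 / 12.

Lemma okamoto_ratio_le a d : near_third a -> (d < 3)%N ->
  `|okamoto_break a d.+1 - okamoto_break a d| <= 1 / 2.
Proof.
rewrite /near_third !ler_norml => /andP[h1 h2].
by case: d => [|[|[|]]]//= _; apply/andP; split; lra.
Qed.

Lemma ratio_mul_le a d (y z : R) : near_third a -> (d < 3)%N -> `|y| <= z ->
  `|(okamoto_break a d.+1 - okamoto_break a d) * y| <= 1 / 2 * z.
Proof. by move=> a3 d3 yz; rewrite normrM ler_pM// okamoto_ratio_le. Qed.

(** Both approximants obey the same self-affinity, whose translation part
    cancels in the difference. *)
Lemma approx_increment a n x : near_third a -> 0 <= x <= 1 ->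
  `|okamoto_approx a n.+1 x - okamoto_approx a n x| <= (1 / 2) ^+ n.
Proof.
move=> a3; elim: n x => [|n IHn] x /ternary_cellP[d d3 [t t01 ->]].
  rewrite approx_affine//= expr0 ler_norml.
  move: a3; rewrite /near_third ler_norml => /andP[h1 h2].
  move/andP: t01 => [t0 t1].
  by case: d d3 => [|[|[|]]]//= _; apply/andP; split; nra.
rewrite !approx_affine// opprD addrACA subrr add0r -mulrBr exprS.
exact/ratio_mul_le/IHn.
Qed.

Lemma approx_bound a n x : near_third a -> 0 <= x <= 1 ->
  `|okamoto_approx a n x| <= 2.
Proof.
move=> a3; elim: n x => [|n IHn] x.
  by move=> /andP[x0 x1]; rewrite ger0_norm//= (le_trans x1)// ler1n.
move=> /ternary_cellP[d d3 [t t01 ->]].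
rewrite approx_affine//; have := ratio_mul_le a3 d3 (IHn _ t01).
set r := _ * okamoto_approx _ _ _; rewrite !ler_norml => /andP[r1 r2].
move: a3; rewrite /near_third ler_norml => /andP[h1 h2].
by case: d d3 @r r1 r2 => [|[|[|]]]//= _ r1 r2; apply/andP; split; lra.
Qed.

Lemma okamoto_cvg a x : near_third a -> 0 <= x <= 1 ->
  cvgn (fun n => okamoto_approx a n x).
Proof.
move=> a3 x01; apply: (@geometric_increments_cvg _ 1 (1 / 2)) => //.
  by apply/andP; split; lra.
by move=> n; rewrite mul1r approx_increment.
Qed.

Lemma okamoto_bound a x : near_third a -> 0 <= x <= 1 -> `|okamoto a x| <= 2.
Proof.
move=> a3 x01.
by apply: cvg_normr_le => [|n]; [exact: okamoto_cvg|exact: approx_bound].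
Qed.

Lemma okamoto_affine a d t : near_third a -> (d < 3)%N -> 0 <= t <= 1 ->
  okamoto a ((d%:R + t) / 3) =
  okamoto_break a d + (okamoto_break a d.+1 - okamoto_break a d) * okamoto a t.
Proof.
move=> a3 d3 t01.
have dt01 : 0 <= (d%:R + t) / 3 <= 1.
  move/andP: t01 => [t0 t1].
  by case: d d3 => [|[|[|]]]//= _; apply/andP; split; lra.
apply: cvg_lim => //; rewrite -cvg_shiftS.
under eq_fun do rewrite approx_affine//.
by apply: cvgD; [exact: cvg_cst|apply: cvgMr; exact: okamoto_cvg].
Qed.

Definition digit_step d : int := if d == 1%N then -2 else 1.

(** The derivative at 1/3 of [okamoto_break a d] with respect to a. *)
Definition break_deriv d : R :=
  match d with 1 => 1 | 2 => -1 | _ => 0 end.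

Lemma okamoto_breakE (y : R) d : (d <= 3)%N ->
  okamoto_break (1 / 3 + y) d = d%:R / 3 + y * break_deriv d.
Proof. by case: d => [|[|[|[|]]]]//= _; field. Qed.

Lemma break_derivS d : (d < 3)%N ->
  break_deriv d.+1 - break_deriv d = (digit_step d)%:~R.
Proof. by case: d => [|[|[|]]]//= _; rewrite /digit_step/= ?mulrNz; ring. Qed.

Lemma digit_step_norm d : `|(digit_step d)%:~R| <= 2 :> R.
Proof. by rewrite -intr_norm /digit_step; case: ifP => _; rewrite ?ler1n. Qed.

Lemma break_deriv_bound d t : (d < 3)%N -> 0 <= t <= 1 ->
  `|break_deriv d + (digit_step d)%:~R * t| <= 1.
Proof.
move=> d3 /andP[t0 t1]; rewrite -break_derivS// ler_norml.
by case: d d3 => [|[|[|]]]//= _; apply/andP; split; lra.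
Qed.

Lemma ternary_split x : { p : nat * R | 0 <= x <= 1 ->
  [/\ (p.1 < 3)%N, 0 <= p.2 <= 1 & x = (p.1%:R + p.2) / 3]}.
Proof.
have [x01|x01] := boolP (0 <= x <= 1); last by exists (0%N, 0).
apply: cid; have [d d3 [t t01 xE]] := ternary_cellP x01.
by exists (d, t).
Qed.

(** Picard iterates for the equation that K satisfies, one ternary expansion
    of each point being chosen once and for all. *)
Fixpoint takagi n x : R :=
  if n is m.+1 then
    let: (d, t) := sval (ternary_split x) in
    break_deriv d + (digit_step d)%:~R * t + takagi m t / 3
  else 0.

(** Differentiating the self-affinity in a at 1/3 gives a contracting equation,
    solved by the limit of its iterates. *)
Lemma takagi_exists : exists G : R -> R,
  (forall x, 0 <= x <= 1 -> `|G x| <= 3 / 2) /\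
  forall x, 0 <= x <= 1 -> exists d, exists t,
    [/\ (d < 3)%N, 0 <= t <= 1, x = (d%:R + t) / 3 &
        G x = break_deriv d + (digit_step d)%:~R * t + G t / 3].
Proof.
have incr n x : 0 <= x <= 1 -> `|takagi n.+1 x - takagi n x| <= (1 / 3) ^+ n.
  elim: n x => [|n IHn] x x01 /=.
    case: ternary_split => -[d t]/= /(_ x01)[d3 t01 xE].
    by rewrite mul0r addr0 subr0 expr0 break_deriv_bound.
  move: (IHn) => /=; case: (ternary_split x) => -[d t]/= /(_ x01)[d3 t01 xE].
  move=> /(_ _ t01); rewrite opprD addrACA subrr add0r -mulrBl normrM.
  by rewrite [`|3^-1|]ger0_norm// exprSr mul1r => /ler_wpM2r; apply.
have bnd n x : 0 <= x <= 1 -> `|takagi n x| <= 3 / 2.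
  elim: n x => [|n IHn] x x01 /=; first by rewrite normr0.
  case: (ternary_split x) => -[d t]/= /(_ x01)[d3 t01 xE].
  have := break_deriv_bound d3 t01; have := IHn _ t01; rewrite !ler_norml.
  by move=> /andP[? ?] /andP[? ?]; apply/andP; split; lra.
have tc x : 0 <= x <= 1 -> cvgn (takagi^~ x).
  move=> x01; apply: (@geometric_increments_cvg _ 1 (1 / 3)) => //.
    by apply/andP; split; lra.
  by move=> n; rewrite mul1r incr.
exists (fun x => limn (takagi^~ x)); split=> [x x01|x x01].
  by apply: cvg_normr_le => [|n]; [exact: tc|exact: bnd].
have := svalP (ternary_split x) x01; case E : (sval _) => [d t]/= [d3 t01 xE].
exists d, t; split => //; apply: cvg_lim => //; rewrite -cvg_shiftS /= E.
by apply: cvgD; [exact: cvg_cst|apply: cvgMl; exact: tc].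
Qed.

(** The error e of the first-order expansion satisfies
    e((d + t)/3) = r_d e(t) + y^2 w_d G(t), with |r_d| <= 1/2. *)
Lemma takagi_error (G : R -> R) :
  (forall x, 0 <= x <= 1 -> `|G x| <= 3 / 2) ->
  (forall x, 0 <= x <= 1 -> exists d, exists t,
    [/\ (d < 3)%N, 0 <= t <= 1, x = (d%:R + t) / 3 &
        G x = break_deriv d + (digit_step d)%:~R * t + G t / 3]) ->
  forall y x, `|y| <= 1 / 12 -> 0 <= x <= 1 ->
  `|okamoto (1 / 3 + y) x - x - y * G x| <= 6 * y ^+ 2.
Proof.
move=> Gb Geq y x y12 x01.
have a3 : near_third (1 / 3 + y) by rewrite /near_third addrAC subrr add0r.
have -> : 6 * y ^+ 2 = 3 * y ^+ 2 / (1 - 1 / 2) by field.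
pose e x := okamoto (1 / 3 + y) x - x - y * G x.
apply: (@contracted_bound e _ _ 4 _ _ _ x x01); first by apply/andP; split; lra.
  move=> t t01; have := okamoto_bound a3 t01.
  have : `|y * G t| <= 1 / 12 * (3 / 2) by rewrite normrM ler_pM// Gb.
  move: t01; rewrite /e !ler_norml => /andP[? ?] /andP[? ?] /andP[? ?].
  by apply/andP; split; lra.
move=> _ /Geq[d [t [d3 t01 -> GE]]]; exists t => //.
have -> : e ((d%:R + t) / 3) =
    (okamoto_break (1 / 3 + y) d.+1 - okamoto_break (1 / 3 + y) d) * e t +
    y ^+ 2 * ((digit_step d)%:~R * G t).
  rewrite /e okamoto_affine// GE !okamoto_breakE ?(ltnW d3)// -break_derivS//.
  by rewrite -natr1; field.
rewrite (le_trans (ler_normD _ _))// lerD ?ratio_mul_le//.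
rewrite normrM (ger0_norm (sqr_ge0 _)) mulrC ler_wpM2r ?sqr_ge0//.
rewrite normrM (_ : 3 = 2 * (3 / 2)); last by field.
by rewrite ler_pM ?digit_step_norm ?Gb.
Qed.

Lemma quadratic_error_derive1 (f : R -> R) x0 l (r C : R) : 0 < r ->
  (forall y, `|y| <= r -> `|f (x0 + y) - f x0 - y * l| <= C * y ^+ 2) ->
  derive1 f x0 = l.
Proof.
move=> r0 fC; apply: cvg_lim => //; apply/cvgrPdist_le => e e0.
have C0 : 0 <= C.
  have rr : `|r| <= r by rewrite ger0_norm// ltW.
  have := le_trans (normr_ge0 _) (fC r rr).
  by rewrite pmulr_lge0// exprn_gt0.
have C1 : 0 < C + 1 by rewrite ltr_pwDr.
near=> h.
have h0 : h != 0 by near: h; exact: nbhs_dnbhs_neq.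
have hr : `|h| <= r by near: h; apply: dnbhs0_le.
have he : `|h| <= e / (C + 1) by near: h; apply: dnbhs0_le; rewrite divr_gt0.
have -> : l - h^-1 *: (f (h + x0) - f x0) =
    - (h^-1 * (f (x0 + h) - f x0 - h * l)).
  by rewrite [h + x0]addrC /GRing.scale/=; field.
rewrite normrN normrM normfV mulrC ler_pdivrMr ?normr_gt0//.
rewrite (le_trans (fC _ hr))// -(real_normK (num_real h)) exprS expr1 mulrA.
rewrite ler_wpM2r// (@le_trans _ _ (C * (e / (C + 1))))//.
  by rewrite ler_wpM2l.
by rewrite mulrCA -[leRHS]mulr1 ler_wpM2l ?(ltW e0)// ler_pdivrMr// mul1r lerDl.
Unshelve. all: by end_near.
Qed.

Lemma okamoto_third x : 0 <= x <= 1 -> okamoto (1 / 3) x = x.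
Proof.
move=> x01; have [G [Gb Ge]] := takagi_exists.
have := @takagi_error G Gb Ge 0 x; rewrite normr0 addr0 mul0r subr0 expr0n/=.
by rewrite mulr0 normr_le0 subr_eq0 => h; apply/eqP/h => //.
Qed.

Lemma okamotoK_takagi :
  (forall x, 0 <= x <= 1 -> `|@okamotoK R x| <= 3 / 2) /\
  forall y x : R, `|y| <= 1 / 12 -> 0 <= x <= 1 ->
    `|okamoto (1 / 3 + y) x - x - y * okamotoK x| <= 6 * y ^+ 2.
Proof.
have [G [Gb Ge]] := takagi_exists.
have KG x : 0 <= x <= 1 -> okamotoK x = G x.
  move=> x01; apply: (@quadratic_error_derive1 _ _ _ (1 / 12) 6) => // y y12.
  by rewrite okamoto_third//; apply: takagi_error.
split=> [x x01|y x y12 x01]; rewrite KG//; first exact: Gb.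
exact: takagi_error.
Qed.

Lemma okamotoK_bound x : 0 <= x <= 1 -> `|okamotoK x| <= 3 / 2.
Proof. by move: x; case: okamotoK_takagi. Qed.

(** The construction of K gives this along one ternary expansion of each point
    only. Comparing the linear terms in y on both sides of the self-affinity of
    F_(1/3 + y) gives it along every expansion. *)
Lemma okamotoK_affine d t : (d < 3)%N -> 0 <= t <= 1 ->
  okamotoK ((d%:R + t) / 3) =
  break_deriv d + (digit_step d)%:~R * t + okamotoK t / 3.
Proof.
move=> d3 t01; have [Kb Ke] := okamotoK_takagi.
have x01 : 0 <= (d%:R + t) / 3 <= 1.
  move/andP: t01 => [t0 t1].
  by case: d d3 => [|[|[|]]]//= _; apply/andP; split; lra.
apply/eqP; rewrite -subr_eq0 -normr_le0; set Z := _ - _.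
apply/ler_addgt0Pr => e e0; rewrite add0r.
pose y := Num.min (1 / 12) (e / 12).
have y0 : 0 < y by rewrite lt_min; apply/andP; split; lra.
have ye : y <= e / 12 by rewrite ge_min lexx orbT.
have y12 : y <= 1 / 12 by rewrite ge_min lexx.
have y12' : `|y| <= 1 / 12 by rewrite ger0_norm// ltW.
have a3 : near_third (1 / 3 + y) by rewrite /near_third addrAC subrr add0r.
have e1 := Ke _ _ y12' x01; have e2 := Ke _ _ y12' t01.
suff : `|y * Z| <= 12 * y ^+ 2.
  rewrite normrM (gtr0_norm y0) expr2 mulrCA ler_pM2l// => /le_trans; apply.
  by rewrite mulrC -ler_pdivlMr.
have -> : y * Z =
   y ^+ 2 * ((digit_step d)%:~R * okamotoK t) +
   (okamoto_break (1 / 3 + y) d.+1 - okamoto_break (1 / 3 + y) d) *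
     (okamoto (1 / 3 + y) t - t - y * okamotoK t) -
   (okamoto (1 / 3 + y) ((d%:R + t) / 3) - (d%:R + t) / 3 -
      y * okamotoK ((d%:R + t) / 3)).
  rewrite okamoto_affine// !okamoto_breakE ?(ltnW d3)// /Z -break_derivS//.
  by rewrite -natr1; field.
rewrite (_ : 12 * _ = 2 * (3 / 2) * y ^+ 2 + 1 / 2 * (6 * y ^+ 2) + 6 * y ^+ 2);
  last by field.
rewrite (le_trans (ler_normB _ _))// lerD//.
rewrite (le_trans (ler_normD _ _))// lerD ?ratio_mul_le//.
rewrite mulrC [leLHS]normrM (ger0_norm (sqr_ge0 _)) ler_wpM2r ?sqr_ge0//.
by rewrite normrM ler_pM ?digit_step_norm ?Kb.
Qed.

End Derivative.

(** * The slope walk *)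

Section Cells.

(** Cells of order n are numbered by j < 3^n; the parent of the cell j is
    j %/ 3, so this sums u over the path from [0, 1] to the cell. *)
Fixpoint walk (u : nat -> int) n j : int :=
  if n is m.+1 then walk u m (j %/ 3)%N + u (j %% 3)%N else 0.

Lemma walkN u n j : walk (fun d => - u d) n j = - walk u n j.
Proof. by elim: n j => [|n IHn] j /=; rewrite ?oppr0// IHn opprD. Qed.

Context {R : realType}.
Implicit Types (f : R -> R) (x y t M e : R) (n k j d : nat).

Lemma okamotoK0 : okamotoK 0 = 0 :> R.
Proof.
have := @okamotoK_affine R 0 0 isT; rewrite lexx ler01 => /(_ isT).
by rewrite /= !mulr0 !addr0 mul0r add0r; lra.
Qed.

Lemma okamotoK1 : okamotoK 1 = 0 :> R.
Proof.
have := @okamotoK_affine R 2 1 isT; rewrite lexx ler01 => /(_ isT).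
by rewrite (_ : (2 + 1) / 3 = 1 :> R) ?divff//=; lra.
Qed.

(** Passing to the child d of a cell adds [digit_step d] to the walk, by
    [okamotoK_affine] applied to the scaled copy. *)
Lemma okamotoK_cell n j : (j < 3 ^ n)%N -> exists A, forall t, 0 <= t <= 1 ->
  okamotoK ((j%:R + t) / 3 ^+ n) =
    A + (3 * (walk digit_step n j)%:~R * t + okamotoK t) / 3 ^+ n :> R.
Proof.
elim: n j => [|n IHn] j jn.
  exists 0 => t _; rewrite expr0 !divr1 /= mulr0 mul0r !add0r.
  by move: jn; rewrite ltnS leqn0 => /eqP->; rewrite add0r.
have jn3 : (j %/ 3 < 3 ^ n)%N by rewrite ltn_divLR// -expnSr.
have [A KA] := IHn _ jn3.
have p3 : 3 ^+ n != 0 :> R := pow3_neq0 n.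
exists (A + ((walk digit_step n (j %/ 3)%N)%:~R * (j %% 3)%N%:R +
   break_deriv (j %% 3)%N) / 3 ^+ n) => t t01.
have d3 : (j %% 3 < 3)%N by rewrite ltn_mod.
have dt01 : 0 <= ((j %% 3)%N%:R + t) / 3 <= 1.
  move/andP: t01 => [t0 t1].
  by case: (j %% 3)%N d3 => [|[|[|]]]//= _; apply/andP; split; lra.
have -> : (j%:R + t) / 3 ^+ n.+1 =
    ((j %/ 3)%N%:R + ((j %% 3)%N%:R + t) / 3) / 3 ^+ n.
  by rewrite {1}(divn_eq j 3) natrD natrM exprS; field.
by rewrite KA// okamotoK_affine//= rmorphD/= exprS; field.
Qed.

Lemma okamotoK_cellB n j t t' : (j < 3 ^ n)%N -> 0 <= t <= 1 -> 0 <= t' <= 1 ->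
  okamotoK ((j%:R + t') / 3 ^+ n) - okamotoK ((j%:R + t) / 3 ^+ n) =
  (3 * (walk digit_step n j)%:~R * (t' - t) + (okamotoK t' - okamotoK t))
    / 3 ^+ n.
Proof.
move=> jn t01 t'01; have [A KA] := okamotoK_cell jn.
have p3 : 3 ^+ n != 0 :> R := pow3_neq0 n.
by rewrite !KA//; field.
Qed.

Lemma derivative_pinftyP f x : derivative_pinfty f x <->
  forall M, exists2 e, 0 < e & forall h, h != 0 -> `|h| < e ->
    0 <= x + h <= 1 -> M <= (f (x + h) - f x) / h.
Proof.
rewrite /derivative_pinfty /increments01; split => [/cvgryPge fx M|fx].
  have /nbhs_ballP[e /= e0 eh] := fx M.
  exists e => // h h0 he xh; apply: eh => //=.
  by rewrite /ball/= sub0r normrN.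
apply/cvgryPge => M; have [e e0 eh] := fx M.
apply/nbhs_ballP; exists e => //= h; rewrite /ball/= sub0r normrN => he h0 xh.
exact: eh.
Qed.

Lemma derivative_ninftyE f x :
  derivative_ninfty f x = derivative_pinfty (fun y => - f y) x.
Proof.
apply/propext; rewrite /derivative_pinfty /derivative_ninfty.
have -> : (fun h => (- f (x + h) - - f x) / h) =
    - (fun h => (f (x + h) - f x) / h).
  by apply/funext => h; rewrite !fctE -mulNr opprB opprK addrC.
by rewrite cvgNry.
Qed.

Definition cell n x := Num.truncn (3 ^+ n * x).

Lemma cell_itv n x : 0 <= x -> (cell n x)%:R <= 3 ^+ n * x < (cell n x).+1%:R.
Proof. by move=> x0; rewrite truncn_itv// mulr_ge0 ?(ltW (pow3_gt0 n)). Qed.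

Lemma cellP n x j : j%:R <= 3 ^+ n * x < j.+1%:R -> cell n x = j.
Proof. exact: truncn_def. Qed.

Lemma cell_ltn n x : 0 <= x < 1 -> (cell n x < 3 ^ n)%N.
Proof.
move=> /andP[x0 x1]; rewrite -(ltr_nat R) nat3E.
have /andP[h _] := cell_itv n x0; rewrite (le_lt_trans h)//.
by rewrite -[ltRHS]mulr1 ltr_pM2l// pow3_gt0.
Qed.

Lemma cell_div3 n x : 0 <= x -> (cell n.+1 x %/ 3)%N = cell n x.
Proof.
move=> x0; apply/esym/cellP; have /andP[h1 h2] := cell_itv n.+1 x0.
move: h1 h2; set j := cell _ _; rewrite exprS -mulrA => h1 h2.
apply/andP; split.
  rewrite -(@ler_pM2l _ 3)// (le_trans _ h1)// -natrM ler_nat mulnC.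
  exact: leq_divM.
rewrite -(@ltr_pM2l _ 3)// (lt_le_trans h2)// -natrM ler_nat mulnC.
by rewrite ltn_ceil.
Qed.

Lemma pow3_inv_lt e : 0 < e ->
  exists N, forall n, (N <= n)%N -> (3 ^+ n)^-1 < e.
Proof.
move=> e0; exists (Num.truncn e^-1) => n Nn.
have n3 : n.+1%:R <= 3 ^+ n :> R by rewrite -nat3E ler_nat ltn_expl.
rewrite -[e]invrK ltf_pV2 ?posrE ?invr_gt0 ?pow3_gt0//.
rewrite (lt_le_trans (truncnS_gt _))// (le_trans _ n3)//.
by rewrite ler_nat ltnS.
Qed.

(** The mean slope over a small interval around x is a convex combination of
    two difference quotients at x. *)
Lemma derivative_pinfty_cell f x M : 0 <= x < 1 -> derivative_pinfty f x ->
  exists N, forall n, (N <= n)%N -> M <=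
    (f ((cell n x).+1%:R / 3 ^+ n) - f ((cell n x)%:R / 3 ^+ n)) * 3 ^+ n.
Proof.
move=> x01 /derivative_pinftyP/(_ M)[e e0 fx].
have [N Ne] := pow3_inv_lt e0; exists N => n /Ne ne.
have /andP[x0 x1] := x01; have p3 := pow3_gt0 n : 0 < _ :> R.
have /andP[] := cell_itv n x0; rewrite mulrC -ler_pdivrMr// -ltr_pdivlMr//.
set j := cell n x; set l := j%:R / _; set r := j.+1%:R / _ => lx xr.
have rl : r - l = (3 ^+ n)^-1.
  by rewrite /r /l -[j.+1%:R]natr1; field; exact: pow3_neq0.
have l0 : 0 <= l by rewrite divr_ge0// ltW.
have r1 : r <= 1.
  by rewrite ler_pdivrMr// mul1r -nat3E ler_nat cell_ltn.
have Mr : M * (r - x) <= f r - f x.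
  rewrite -ler_pdivlMr ?subr_gt0//.
  have := fx (r - x); rewrite addrCA subrr addr0; apply.
  - by rewrite subr_eq0 gt_eqF.
  - by rewrite gtr0_norm ?subr_gt0//; lra.
  - by rewrite r1 andbT (le_trans l0)//; lra.
have Ml : M * (x - l) <= f x - f l.
  have [->|lx'] := eqVneq l x; first by rewrite !subrr mulr0.
  have {lx'}lx : l < x by rewrite lt_neqAle lx'.
  rewrite -ler_pdivlMr ?subr_gt0//.
  have := fx (l - x); rewrite addrCA subrr addr0.
  have -> : (f l - f x) / (l - x) = (f x - f l) / (x - l).
    by rewrite -[f l - _]opprB -[l - x]opprB invrN mulrNN.
  apply.
  - by rewrite subr_eq0 lt_eqF.
  - by rewrite ltr0_norm ?subr_lt0//; lra.
  - by rewrite l0/=; lra.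
rewrite -ler_pdivrMr// -rl; lra.
Qed.

(** K vanishes at 0 and 1, so only the affine part contributes. *)
Lemma okamotoK_cell_slope n x : 0 <= x < 1 ->
  (okamotoK ((cell n x).+1%:R / 3 ^+ n) - okamotoK ((cell n x)%:R / 3 ^+ n))
    * 3 ^+ n = 3 * (walk digit_step n (cell n x))%:~R :> R.
Proof.
move=> x01; have := @okamotoK_cellB n (cell n x) 0 1 (cell_ltn n x01).
rewrite !lexx ler01 addr0 natr1 => /(_ isT isT) ->.
by rewrite okamotoK0 okamotoK1; field; exact: pow3_neq0.
Qed.

Definition walk_pinfty (u : nat -> int) : set R :=
  [set x | 0 <= x < 1 /\ forall M : nat, exists N, forall n, (N <= n)%N ->
     M%:Z <= walk u n (cell n x)].

(** The point 1 is set apart because it lies in no half-open cell of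
    [0, 1). *)
Lemma infinite_derivative_walk : infinite_derivative_set (@okamotoK R) `<=`
  walk_pinfty digit_step `|` walk_pinfty (fun d => - digit_step d) `|` [set 1].
Proof.
move=> x [/andP[x0]]; rewrite le_eqVlt => /predU1P[->|x1 Kx]; first by right.
have x01 : 0 <= x < 1 by rewrite x0.
left; case: Kx => [Kx|]; [left|rewrite derivative_ninftyE => Kx; right];
  split => // M; have [N NM] := derivative_pinfty_cell (3 * M%:R) x01 Kx;
  exists N => n /NM.
- by rewrite okamotoK_cell_slope// ler_pM2l// (pmulrn _ M) ler_int.
- rewrite -opprD mulNr okamotoK_cell_slope// walkN -mulrN ler_pM2l//.
  by rewrite -rmorphN (pmulrn _ M) ler_int.
Qed.

End Cells.

(** * A centered walk almost never tends to infinity *)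

Section LebesgueOuter.
Context {R : realType}.
Implicit Types A B : set R.

(** On arbitrary sets [lebesgue_measure] is the Lebesgue outer measure. *)
Lemma lebesgue_measure_sub A B : A `<=` B ->
  (lebesgue_measure A <= lebesgue_measure B)%E.
Proof. exact: (@le_outer_measure _ _ (@lebesgue_measure R)). Qed.

Lemma lebesgue_measure_ge0 A : (0 <= lebesgue_measure A)%E.
Proof. exact: (@outer_measure_ge0 _ _ (@lebesgue_measure R)). Qed.

Lemma lebesgue_measure_bigcup_le (A_ : (set R)^nat) :
  (lebesgue_measure (\bigcup_n A_ n) <= \sum_(n <oo) lebesgue_measure (A_ n))%E.
Proof. exact: (@outer_measure_sigma_subadditive _ _ (@lebesgue_measure R)). Qed.

Lemma lebesgue_measure_bigcup0 (A_ : (set R)^nat) :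
  (forall n, lebesgue_measure (A_ n) = 0)%E ->
  lebesgue_measure (\bigcup_n A_ n) = 0%E.
Proof.
move=> A0; apply/eqP; rewrite eq_le lebesgue_measure_ge0 andbT.
by rewrite (le_trans (lebesgue_measure_bigcup_le _))// eseries0.
Qed.

End LebesgueOuter.

Section StoppedWalk.
Variable u : nat -> int.
Hypothesis u_centered : u 0%N + u 1%N + u 2%N = 0.
Hypothesis u_ge : forall d, -2 <= u d.

Fixpoint stopped_walk (s : int) n j : int :=
  if n is m.+1 then
    let v := stopped_walk s m (j %/ 3)%N in
    if 0 <= v then v + u (j %% 3)%N else v
  else s.

(** The walk stops as soon as it is negative, and a step from a nonnegative
    value goes no lower than -2. *)
Lemma stopped_walk_ge s n j : -2 <= s -> -2 <= stopped_walk s n j.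
Proof.
move=> s2; elim: n j => [|n IHn] j//=.
by case: ifPn => // v0; have := u_ge (j %% 3); lia.
Qed.

Lemma big_nat_triple n (F : nat -> int) :
  \sum_(0 <= j < n * 3) F j =
  \sum_(0 <= i < n) (F (i * 3)%N + F (i * 3 + 1)%N + F (i * 3 + 2)%N).
Proof.
elim: n => [|n IHn]; first by rewrite !big_geq.
rewrite mulSn addnC !addnS addn0 !big_nat_recr//= IHn.
by rewrite -!addrA addn1 addn2.
Qed.

(** The martingale property: the three children of a cell either inherit its
    value or receive steps of sum 0. *)
Lemma sum_stopped_walk s n :
  \sum_(0 <= j < 3 ^ n) stopped_walk s n j = s * (3 ^ n)%:Z.
Proof.
elim: n => [|n IHn]; first by rewrite expn0 big_nat1 /= mulr1.
rewrite expnSr big_nat_triple PoszM mulrA -IHn big_distrl/=.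
apply: eq_bigr => j _.
rewrite /= mulnK// modnMl !divnMDl// !modnMDl !divn_small// !modn_small//.
rewrite !addn0.
by case: ifPn => _ /=; lia.
Qed.

Lemma stopped_walk_full s n (c : nat -> nat) :
  (forall k, c k.+1 %/ 3 = c k)%N ->
  (forall k, 0 <= s + walk u k (c k)) ->
  stopped_walk s n (c n) = s + walk u n (c n).
Proof.
move=> c3 sw; elim: n => [|n IHn] /=; first by rewrite addr0.
by rewrite c3 IHn sw addrA.
Qed.

Context {R : realType}.

Definition triadic_itv n j : set R :=
  `[j%:R / 3 ^+ n, j.+1%:R / 3 ^+ n[%classic.

Lemma lebesgue_measure_triadic_itv n j :
  lebesgue_measure (triadic_itv n j) = (3 ^+ n)^-1%:E.
Proof.
rewrite lebesgue_measure_itv/= lte_fin ltr_pM2r ?invr_gt0 ?pow3_gt0//.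
rewrite ltr_nat ltnSn -EFinB; congr EFin.
by rewrite -[j.+1%:R]natr1; field; exact: pow3_neq0.
Qed.

Definition high_cells (s L n : nat) : set R :=
  \big[setU/set0]_(0 <= j < 3 ^ n | L%:Z <= stopped_walk s%:Z n j)
     triadic_itv n j.

Lemma measurable_high_cells s L n : measurable (high_cells s L n).
Proof. by apply: bigsetU_measurable => j _; exact: measurable_itv. Qed.

Lemma cell_high_cells s L n x : 0 <= x < 1 ->
  L%:Z <= stopped_walk s%:Z n (cell n x) -> high_cells s L n x.
Proof.
move=> x01 Lx; rewrite /high_cells -bigcup_seq_cond.
exists (cell n x); first by rewrite /= mem_index_iota/= cell_ltn.
have /andP[x0 _] := x01; have /andP[h1 h2] := @cell_itv R n x x0.
by rewrite /triadic_itv/= in_itv/= ler_pdivrMr ?ltr_pdivlMr ?pow3_gt0// mulrC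
  h1.
Qed.

(** Markov's inequality for the nonnegative martingale obtained by adding 2 to
    the stopped walk. *)
Lemma high_cells_measure s L n :
  (lebesgue_measure (high_cells s L n) <= ((s%:R + 2) / (L%:R + 2))%:E)%E.
Proof.
have L2 : 0 < L%:R + 2 :> R by rewrite ltr_wpDl.
have d0 : 0 < 3 ^+ n * (L%:R + 2) :> R by rewrite mulr_gt0// pow3_gt0.
pose P j := L%:Z <= stopped_walk s%:Z n j.
have X0 j : 0 <= (stopped_walk s%:Z n j + 2)%:~R :> R.
  by rewrite ler0z -lerBlDr sub0r stopped_walk_ge.
apply: (@le_trans _ _ (\sum_(j < 3 ^ n)
    ((stopped_walk s%:Z n j + 2)%:~R / (3 ^+ n * (L%:R + 2)))%:E)%E).
  pose F j := if P j then triadic_itv n j else set0.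
  have mF k : measurable (F k).
    by rewrite /F; case: ifP => // _; exact: measurable_itv.
  apply: (@le_trans _ _ (\sum_(j < 3 ^ n) lebesgue_measure (F j))%E).
    apply: content_subadditive; [by move=> k _; exact: mF| |].
      exact: measurable_high_cells.
    by rewrite /high_cells big_mkcond big_mkord.
  apply: lee_sum => j _; rewrite /F; case: ifPn => Pj; last first.
    by rewrite measure0 lee_fin divr_ge0// ltW.
  rewrite lebesgue_measure_triadic_itv lee_fin ler_pdivlMr//.
  rewrite mulKf ?pow3_neq0// -[2]/(2%:~R) pmulrn -rmorphD/= ler_int.
  by rewrite lerD2r.
rewrite sumEFin lee_fin -big_distrl/= -rmorph_sum/= big_split/= sumr_const.
rewrite card_ord -(big_mkord xpredT (fun j => stopped_walk s%:Z n j)).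
rewrite sum_stopped_walk -(mulr_natr 2 (3 ^ n)) (natz (3 ^ n)) -mulrDl.
rewrite rmorphM rmorphD/=.
rewrite -!pmulrn nat3E le_eqVlt; apply/orP; left; apply/eqP; field.
by rewrite pow3_neq0 gt_eqF.
Qed.

Definition eventually_high s L : set R :=
  \bigcup_N \bigcap_n high_cells s L (N + n).

Lemma measurable_bigcap_high_cells s L N :
  measurable (\bigcap_n high_cells s L (N + n)).
Proof. by apply: bigcapT_measurable => n; exact: measurable_high_cells. Qed.

Lemma measurable_eventually_high s L : measurable (eventually_high s L).
Proof.
by apply: bigcupT_measurable => N; exact: measurable_bigcap_high_cells.
Qed.

(** Continuity of the measure along the increasing sequence of the
    intersections, each of which lies in a single set of high cells. *)
Lemma eventually_high_measure s L :
  (lebesgue_measure (eventually_high s L) <= ((s%:R + 2) / (L%:R + 2))%:E)%E.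
Proof.
pose T N := \bigcap_n high_cells s L (N + n).
have cvgT : lebesgue_measure (T N) @[N --> \oo] -->
    lebesgue_measure (\bigcup_N T N).
  apply: nondecreasing_cvg_mu.
  - exact: measurable_bigcap_high_cells.
  - exact: measurable_eventually_high.
  - move=> N N' NN'; apply/subsetPset => x Tx n _.
    by rewrite -(subnKC NN') -addnA; exact: Tx.
rewrite -(cvg_lim _ cvgT)//; apply: lime_le.
  by apply/cvg_ex; eexists; exact: cvgT.
apply: nearW => N; apply: le_trans (high_cells_measure s L N).
apply: le_measure; rewrite ?inE.
- exact: measurable_bigcap_high_cells.
- exact: measurable_high_cells.
- by move=> x /(_ 0%N I); rewrite addn0.
Qed.

(** A walk that tends to +oo is bounded below, hence is never stopped when its
    starting point is high enough. *)
Lemma walk_pinfty_start (x : R) : walk_pinfty u x ->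
  exists s : nat, forall n, 0 <= s%:Z + walk u n (cell n x).
Proof.
move=> [/andP[x0 _] /(_ 0%N)[N walkN0]].
exists (2 * N)%N => n; have [/walkN0|/ltnW nN] := leqP N n; first lia.
suff : - (2 * n)%:Z <= walk u n (cell n x) by lia.
elim: {nN}n => [|n IHn] /=; first by rewrite muln0.
by have := u_ge (cell n.+1 x %% 3); rewrite cell_div3//; lia.
Qed.

(** The points whose walk, started at s, is never stopped and tends to +oo are
    eventually in high cells of every level L, so they form a set of measure
    at most (s + 2) / (L + 2) for all L. *)
Lemma walk_pinfty_null : lebesgue_measure (walk_pinfty u : set R) = 0%E.
Proof.
have sub : (walk_pinfty u : set R) `<=`
    \bigcup_s \bigcap_L eventually_high s L.
  move=> x ux; have [s sx] := walk_pinfty_start ux.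
  exists s => // L _; case: ux => x01 /(_ L)[N walkNL]; exists N => // n _.
  apply: cell_high_cells => //.
  rewrite (@stopped_walk_full s (N + n) (cell ^~ x))//.
    by have := walkNL (N + n)%N (leq_addr _ _); lia.
  by move=> k; apply: cell_div3; case/andP: x01.
apply/eqP; rewrite eq_le lebesgue_measure_ge0 andbT.
rewrite (le_trans (lebesgue_measure_sub sub))//.
rewrite lebesgue_measure_bigcup0// => s.
apply/eqP; rewrite eq_le lebesgue_measure_ge0 andbT.
apply/lee_addgt0Pr => e e0; rewrite add0e.
pose L := Num.truncn ((s%:R + 2) / e).
apply: (@le_trans _ _ (lebesgue_measure (eventually_high s L))); last first.
  apply: (le_trans (eventually_high_measure s L)).
  rewrite lee_fin ler_pdivrMr ?ltr_wpDl// mulrC -ler_pdivrMr//.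
  rewrite (le_trans (ltW (truncnS_gt _)))// -/L -natr1 lerD2l ler1n//.
by apply: lebesgue_measure_sub; exact: bigcap_inf.
Qed.

End StoppedWalk.

Section NullSet.
Context {R : realType}.

Lemma infinite_derivative_null :
  lebesgue_measure (infinite_derivative_set (@okamotoK R)) = 0%E.
Proof.
pose A_ n : set R := match n with
  | 0 => walk_pinfty digit_step
  | 1 => walk_pinfty (fun d => - digit_step d)
  | _ => [set 1] end.
have sub : infinite_derivative_set (@okamotoK R) `<=` \bigcup_n A_ n.
  move=> x /infinite_derivative_walk[[ux|ux]|x1].
  - by exists 0%N.
  - by exists 1%N.
  - by exists 2%N.
apply/eqP; rewrite eq_le lebesgue_measure_ge0 andbT.
rewrite (le_trans (lebesgue_measure_sub sub))//.
rewrite lebesgue_measure_bigcup0// => -[|[|n]]/=.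
- by apply: walk_pinfty_null => // d; rewrite /digit_step; case: ifP.
- by apply: walk_pinfty_null => // d; rewrite /digit_step; case: ifP.
- exact: lebesgue_measure_set1.
Qed.

End NullSet.

(** * Comparison of Hausdorff and Lebesgue measures *)

Section HausdorffBounds.
Context {R : realType}.
Implicit Types (A U : set R) (s e C : R) (c : R -> R).
Local Open Scope ereal_scope.

Lemma diam_pow_ge0 s U : 0 <= diam_pow s U.
Proof. by rewrite /diam_pow; case: ifP => // _; exact: poweR_ge0. Qed.

Lemma hausdorff_premeasure_ge0 s e A : 0 <= hausdorff_premeasure s e A.
Proof.
apply: le_ereal_inf_tmp => _ [U _ <-].
by apply: nneseries_ge0 => n _ _; exact: diam_pow_ge0.
Qed.

Lemma diam_dist U x y : U x -> U y -> `|x - y|%:E <= diam U.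
Proof. by move=> Ux Uy; apply: ereal_sup_ubound; exists x => //; exists y. Qed.

Lemma diam_ge0 U x : U x -> 0 <= diam U.
Proof. by move=> Ux; have := diam_dist Ux Ux; rewrite subrr normr0. Qed.

Lemma diam_ocitv U : ocitv U -> diam U <= wlength idfun U.
Proof.
move=> /ocitvP[->|[[a b] /= ab ->]].
  by apply/ereal_supP => _ [x []].
rewrite wlength_itv_bnd ?(ltW ab)//.
apply/ereal_supP => _ [x + [y + <-]]; rewrite /= !in_itv/=.
move=> /andP[ax xb] /andP[ay yb]; rewrite lee_fin ler_norml.
by apply/andP; split; lra.
Qed.

(** Lebesgue outer measure is an infimum over covers by half-open intervals, and
    such a cover is fine enough for the Hausdorff measure as soon as its total
    length is below the prescribed mesh. *)
Lemma hausdorff_measure1_null A : lebesgue_measure A = 0 ->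
  hausdorff_measure 1 A = 0.
Proof.
move=> A0.
have pre0 d : (0 < d)%R -> hausdorff_premeasure 1 d A = 0.
  move=> d0; apply/eqP; rewrite eq_le hausdorff_premeasure_ge0 andbT.
  apply/lee_addgt0Pr => e e0; rewrite add0e.
  have m0 : (0 < Num.min d e)%R by rewrite lt_min d0.
  have A0' : (wlength (@idfun R))^*%mu A = 0 := A0.
  have Afin : (wlength (@idfun R))^*%mu A \is a fin_num by rewrite A0'.
  have [_ [/= F [mF AF] <-]] := lb_ereal_inf_adherent m0 Afin.
  rewrite -/(mu_ext _ _) A0' add0e => sumF.
  have Fsum i : wlength (@idfun R) (F i) <= \sum_(k <oo) wlength idfun (F k).
    rewrite (nneseriesD1 (n := i))//=.
    by apply: leeDl; apply: nneseries_ge0 => k _ _; exact: wlength_ge0.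
  apply: (@le_trans _ _ (\sum_(k <oo) wlength (@idfun R) (F k))).
    apply: ge_ereal_inf; exists (\sum_(0 <= i <oo) diam_pow 1 (F i)).
      exists F => //; split => // i.
      rewrite (le_trans (diam_ocitv (mF i)))// (le_trans (Fsum i))//.
      by rewrite (le_trans (ltW sumF))// lee_fin ge_min lexx.
    apply: lee_nneseries => [i _ _|i _]; first exact: diam_pow_ge0.
    rewrite /diam_pow; case: ifPn => [_|/set0P[x Fx]].
      exact: wlength_ge0.
    by rewrite poweRe1; [exact/diam_ocitv/mF|exact: diam_ge0 Fx].
  by rewrite (le_trans (ltW sumF))// lee_fin ge_min lexx orbT.
rewrite /hausdorff_measure (_ : [set _ | _ in _] = [set 0]) ?ereal_sup1//.
apply/seteqP; split => [_ [d d0 <-]|_ ->] /=; first by rewrite pre0.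
by exists 1%R => //=; rewrite pre0.
Qed.

(** The preimage under c of a member of a cover lies in an interval whose
    length is at most 2C times the contribution of that member to the Hausdorff
    sum, and these intervals cover [0, 1). *)
Lemma expanding_hausdorff_measure_neq0 A c s C :
  (0 <= s)%R -> (0 < C)%R ->
  (forall y : R, 0 <= y < 1 -> A (c y))%R ->
  (forall y z : R, 0 <= y < 1 -> 0 <= z < 1 ->
    `|y - z| <= C * `|c y - c z| `^ s)%R ->
  hausdorff_measure s A != 0.
Proof.
move=> s0 C0 cA cC; apply/eqP => H0.
have pre0 : hausdorff_premeasure s 1 A = 0.
  apply/eqP; rewrite eq_le hausdorff_premeasure_ge0 andbT -H0.
  by apply: ereal_sup_ubound; exists 1%R => /=.
have e0 : (0 < (2 * C)^-1)%R by rewrite invr_gt0 mulr_gt0.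
have Afin : hausdorff_premeasure s 1 A \is a fin_num by rewrite pre0.
have [_ [/= U [AU U1] <-]] := lb_ereal_inf_adherent e0 Afin.
rewrite -/(hausdorff_premeasure s 1 A) pre0 add0e => sumU.
pose d i := fine (diam_pow s (U i)).
have UE i x : U i x -> exists2 r, (0 <= r)%R & diam (U i) = r%:E.
  move=> Ux; have := diam_ge0 Ux; have := U1 i.
  by case: (diam (U i)) => // r _; rewrite lee_fin => r0; exists r.
have dE i x : U i x -> diam_pow s (U i) = (d i)%:E.
  move=> Ux; have [r r0 rE] := UE _ _ Ux.
  rewrite /d /diam_pow ifF; first by rewrite rE.
  by apply/negbTE/set0P; exists x.
have cd i y z : (0 <= y < 1)%R -> (0 <= z < 1)%R -> U i (c y) -> U i (c z) ->
    (`|y - z| <= C * d i)%R.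
  move=> y01 z01 Uy Uz; rewrite (le_trans (cC _ _ y01 z01))//.
  rewrite ler_wpM2l ?(ltW C0)//.
  have [r r0 rE] := UE _ _ Uy.
  have -> : d i = (r `^ s)%R.
    rewrite /d /diam_pow ifF ?rE//.
    by apply/negbTE/set0P; exists (c y).
  apply: ge0_ler_powR => //; rewrite ?nnegrE ?normr_ge0//.
  by rewrite -lee_fin -rE; exact: diam_dist.
pose V i : set R :=
  if pselect (exists y : R, (0 <= y < 1)%R /\ U i (c y)) is left yP then
    `[(sval (cid yP) - C * d i)%R, (sval (cid yP) + C * d i)%R]%classic
  else set0.
have V01 : `[0%R, 1%R[%classic `<=` \bigcup_i V i.
  move=> y; rewrite /= in_itv/= => y01; have [i _ Ui] := AU _ (cA _ y01).
  exists i => //; rewrite /V; case: pselect => [yP|[]]; last by exists y.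
  case: cid => z /= [z01 Uz]; rewrite in_itv/=.
  have := cd _ _ _ y01 z01 Ui Uz; rewrite ler_norml => /andP[h1 h2].
  by apply/andP; split; lra.
have VU i : lebesgue_measure (V i) <= (2 * C)%:E * diam_pow s (U i).
  rewrite /V; case: pselect => [yP|_]; last first.
    by rewrite measure0 mule_ge0 ?diam_pow_ge0// lee_fin mulr_ge0// ltW.
  case: cid => z /= [z01 Uz]; rewrite (dE _ _ Uz) -EFinM.
  rewrite lebesgue_measure_itv/=; case: ifPn => _.
    by rewrite -EFinB lee_fin; lra.
  rewrite lee_fin !mulr_ge0 ?(ltW C0)//.
  by rewrite /d fine_ge0// diam_pow_ge0.
have : 1 <= (2 * C)%:E * \sum_(0 <= i <oo) diam_pow s (U i).
  have <- : lebesgue_measure (`[0%R, 1%R[%classic : set R) = 1.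
    by rewrite lebesgue_measure_itv/= lte_fin ltr01 oppr0 adde0.
  rewrite (le_trans (lebesgue_measure_sub V01))//.
  rewrite (le_trans (lebesgue_measure_bigcup_le V))//.
  rewrite -nneseriesZl; last by move=> i _; exact: diam_pow_ge0.
  by apply: lee_nneseries => // i _ _; exact: lebesgue_measure_ge0.
apply/negP; rewrite -ltNge.
rewrite -(@lte_pmul2l _ (2 * C)%:E) ?lte_fin ?mulr_gt0// in sumU.
by rewrite (lt_le_trans sumU)// -EFinM divff// gt_eqF// mulr_gt0.
Qed.

End HausdorffBounds.

(** * Coding words by words with positive walk *)

Section Coding.

Lemma walkS u n j : walk u n.+1 j = walk u n (j %/ 3)%N + u (j %% 3)%N.
Proof. by []. Qed.

Lemma walk_cat u n m i b : (b < 3 ^ m)%N ->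
  walk u (n + m) (i * 3 ^ m + b) = walk u n i + walk u m b.
Proof.
elim: m b => [|m IHm] b bm.
  by move: bm; rewrite ltnS leqn0 => /eqP->; rewrite expn0 muln1 !addn0 addr0.
rewrite addnS /= expnSr mulnA divnMDl// modnMDl IHm ?addrA//.
by rewrite ltn_divLR// -expnSr.
Qed.

Fixpoint digit_shift m b : nat :=
  if m is k.+1 then (digit_shift k (b %/ 3) * 3 + (b %% 3).+1 %% 3)%N else 0%N.

Lemma digit_shiftS m b :
  digit_shift m.+1 b = (digit_shift m (b %/ 3) * 3 + (b %% 3).+1 %% 3)%N.
Proof. by []. Qed.

Lemma digit_shift_div m b :
  (digit_shift m.+1 b %/ 3)%N = digit_shift m (b %/ 3)%N.
Proof. by rewrite /= divnMDl// [X in (_ + X)%N]divn_small ?addn0// ltn_pmod. Qed.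

Lemma digit_shift_mod m b : (digit_shift m.+1 b %% 3 = (b %% 3).+1 %% 3)%N.
Proof. by rewrite /= modnMDl modn_mod. Qed.

Lemma digit_shift_ltn m b : (digit_shift m b < 3 ^ m)%N.
Proof.
elim: m b => [|m IHm] b //=; rewrite expnSr.
have := IHm (b %/ 3)%N; have : ((b %% 3).+1 %% 3 < 3)%N by rewrite ltn_mod.
lia.
Qed.

Lemma digit_shift3 m b : (b < 3 ^ m)%N ->
  digit_shift m (digit_shift m (digit_shift m b)) = b.
Proof.
elim: m b => [|m IHm] b bm; first by move: bm; rewrite ltnS leqn0 => /eqP->.
rewrite digit_shiftS !digit_shift_div !digit_shift_mod.
rewrite IHm; last by rewrite ltn_divLR// -expnSr.
rewrite [RHS](divn_eq b 3); congr addn.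
have : (b %% 3 < 3)%N by rewrite ltn_mod.
by case: (b %% 3)%N => [|[|[|]]].
Qed.

(** At each position the three words have the three digits, whose steps sum
    to 0. *)
Lemma walk_shift_sum m b :
  walk digit_step m b + walk digit_step m (digit_shift m b) +
  walk digit_step m (digit_shift m (digit_shift m b)) = 0.
Proof.
elim: m b => [|m IHm] b //; rewrite !walkS.
rewrite !digit_shift_div !digit_shift_mod.
have := IHm (b %/ 3)%N; have : (b %% 3 < 3)%N by rewrite ltn_mod.
by case: (b %% 3)%N => [|[|[|]]]//= _; rewrite /digit_step/=; lia.
Qed.

Definition good_shift m b : nat :=
  if 0 <= walk digit_step m b then 0%N
  else if 0 <= walk digit_step m (digit_shift m b) then 1%N else 2%N.

(** In base 3 these are 0200, 0202 and 0220: the walk gains 4, the last two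
    digits tell the shift, and the first two keep the points coded afterwards
    away from the endpoints of the preceding cell. *)
Definition shift_prefix i : nat := nth 0%N [:: 18; 20; 24]%N i.

Definition block_code m b : nat :=
  (shift_prefix (good_shift m b) * 3 ^ m +
   iter (good_shift m b) (digit_shift m) b)%N.

Lemma good_shift_le2 m b : (good_shift m b <= 2)%N.
Proof. by rewrite /good_shift; case: ifP => //; case: ifP. Qed.

Lemma iter_digit_shift_ltn m i b : (b < 3 ^ m)%N ->
  (iter i (digit_shift m) b < 3 ^ m)%N.
Proof. by case: i => // i _; exact: digit_shift_ltn. Qed.

Lemma iter_digit_shift_inj m i b b' : (i <= 2)%N ->
  (b < 3 ^ m)%N -> (b' < 3 ^ m)%N ->
  iter i (digit_shift m) b = iter i (digit_shift m) b' -> b = b'.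
Proof.
move=> i2 bm bm' E; rewrite -(digit_shift3 bm) -(digit_shift3 bm').
by case: i i2 E => [|[|[|]]]//= _ => [->|->|->].
Qed.

Lemma walk_good_shift m b :
  0 <= walk digit_step m (iter (good_shift m b) (digit_shift m) b).
Proof.
rewrite /good_shift; case: ifPn => //; case: ifPn => //=.
by have := walk_shift_sum m b; lia.
Qed.

Lemma block_code_bounds m b : (b < 3 ^ m)%N ->
  (2 * 3 ^ (m + 2) <= block_code m b)%N /\ (block_code m b < 3 ^ (m + 3))%N.
Proof.
move=> bm; have := iter_digit_shift_ltn (good_shift m b) bm.
have := good_shift_le2 m b; rewrite /block_code /shift_prefix.
rewrite !expnD -[(3 ^ 2)%N]/9%N -[(3 ^ 3)%N]/27%N.
by case: (good_shift m b) => [|[|[|]]]//= _; lia.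
Qed.

Lemma block_code_inj m b b' : (b < 3 ^ m)%N -> (b' < 3 ^ m)%N ->
  block_code m b = block_code m b' -> b = b'.
Proof.
move=> bm bm' E.
have m0 : (0 < 3 ^ m)%N by rewrite expn_gt0.
have l := iter_digit_shift_ltn (good_shift m b) bm.
have l' := iter_digit_shift_ltn (good_shift m b') bm'.
have Ed := congr1 (divn ^~ (3 ^ m)%N) E; have Em := congr1 (modn ^~ (3 ^ m)%N) E.
rewrite /block_code /= in Ed Em.
rewrite !divnMDl// !divn_small// !addn0 in Ed.
rewrite !modnMDl !modn_small// in Em.
have Eg : good_shift m b = good_shift m b'.
  move: Ed; have := good_shift_le2 m b; have := good_shift_le2 m b'.
  by case: (good_shift m b) => [|[|[|]]]//; case: (good_shift m b') => [|[|[|]]].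
rewrite -Eg in Em.
exact: (iter_digit_shift_inj (good_shift_le2 m b) bm bm' Em).
Qed.

Lemma walk_block_code m b : (b < 3 ^ m)%N ->
  1 <= walk digit_step (m + 4) (block_code m b).
Proof.
move=> bm; rewrite addnC walk_cat ?iter_digit_shift_ltn//.
have := walk_good_shift m b; have := good_shift_le2 m b.
rewrite /shift_prefix.
by case: (good_shift m b) => [|[|[|]]]//= _; rewrite /digit_step/=; lia.
Qed.

Fixpoint encode m k a : nat :=
  if k is l.+1 then
    (encode m l (a %/ 3 ^ m) * 3 ^ (m + 4) + block_code m (a %% 3 ^ m))%N
  else 0%N.

Lemma block_code_mod_ltn m a : (block_code m (a %% 3 ^ m) < 3 ^ (m + 4))%N.
Proof.
have am : (a %% 3 ^ m < 3 ^ m)%N by rewrite ltn_mod expn_gt0.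
have [_ h] := block_code_bounds am; rewrite (leq_trans h)//.
by rewrite leq_pexp2l// leq_add2l.
Qed.

Lemma encode_ltn m k a : (encode m k a < 3 ^ (k * (m + 4)))%N.
Proof.
elim: k a => [|k IHk] a //=.
rewrite mulSn [X in (_ < 3 ^ X)%N]addnC (expnD 3 (k * (m + 4))).
have ek := IHk (a %/ 3 ^ m)%N; have ca := block_code_mod_ltn m a.
apply: (@leq_trans ((encode m k (a %/ 3 ^ m)).+1 * 3 ^ (m + 4))).
  by rewrite mulSn [leqRHS]addnC ltn_add2l.
by rewrite leq_mul2r ek orbT.
Qed.

Lemma walk_encode m k a :
  k%:Z <= walk digit_step (k * (m + 4)) (encode m k a).
Proof.
elim: k a => [|k IHk] a //=.
rewrite mulSn addnC walk_cat ?block_code_mod_ltn//.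
have am : (a %% 3 ^ m < 3 ^ m)%N by rewrite ltn_mod expn_gt0.
by have := IHk (a %/ 3 ^ m)%N; have := walk_block_code am; lia.
Qed.

Lemma encode_inj m k a a' : (a < 3 ^ (k * m))%N -> (a' < 3 ^ (k * m))%N ->
  encode m k a = encode m k a' -> a = a'.
Proof.
elim: k a a' => [|k IHk] a a' /=.
  by rewrite !ltnS !leqn0 => /eqP-> /eqP->.
rewrite mulSn addnC expnD -!ltn_divLR ?expn_gt0// => ak ak' E.
have m0 : (0 < 3 ^ (m + 4))%N by rewrite expn_gt0.
have Ed := congr1 (divn ^~ (3 ^ (m + 4))%N) E.
have Em := congr1 (modn ^~ (3 ^ (m + 4))%N) E.
rewrite /= !divnMDl// !(divn_small (block_code_mod_ltn _ _)) !addn0 in Ed.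
rewrite /= !modnMDl !(modn_small (block_code_mod_ltn _ _)) in Em.
rewrite (divn_eq a (3 ^ m)) (divn_eq a' (3 ^ m)) (IHk _ _ ak ak' Ed).
by rewrite (block_code_inj _ _ Em)// ltn_mod expn_gt0.
Qed.

End Coding.

(** * Infinite derivatives at well-centered points *)

Section NestedCells.
Context {R : realType}.
Implicit Types (x y z s : R).

(** Let x + h share with x the k-th of these cells but not the next one. As x
    is away from the endpoints of the next cell, |h| is at least a fixed
    fraction of the length of the k-th one, so the scaled copy of K contributes
    a bounded amount to the difference quotient, and the affine part
    contributes 3 W >= 3k. *)
Lemma nested_cells_derivative L (e : nat -> nat) x :
  (forall k, e k < 3 ^ (k * L))%N ->
  (forall k, (e k)%:R + 2 / 9 <= 3 ^+ (k * L) * x <= (e k)%:R + 1 / 3) ->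
  (forall k, k%:Z <= walk digit_step (k * L) (e k)) ->
  (0 < L)%N -> derivative_pinfty (@okamotoK R) x.
Proof.
move=> eL ex ew L0; apply/derivative_pinftyP => M.
(* the oscillation of K, at most 3, over the relative distance 2/9 * 3^(-L) *)
pose C : R := 27 / 2 * 3 ^+ L.
have C0 : 0 <= C by rewrite mulr_ge0// ltW// pow3_gt0.
pose k0 := Num.truncn (`|M| + C).
have k0M : M <= 3 * k0.+1%:R - C.
  have := truncnS_gt (`|M| + C); rewrite -/k0.
  have := ler_norm M; have := normr_ge0 M; lra.
pose in_cell k z := (e k)%:R <= 3 ^+ (k * L) * z <= (e k).+1%:R.
have far k z : ~~ in_cell k z -> 2 / 9 <= 3 ^+ (k * L) * `|z - x|.
  rewrite -(ger0_norm (ltW (pow3_gt0 (k * L)))) -normrM mulrBr.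
  have /andP[h1 h2] := ex k.
  rewrite /in_cell negb_and -!ltNge => /orP[h|h].
    by rewrite distrC (le_trans _ (ler_norm _))//; lra.
  rewrite (le_trans _ (ler_norm _))//.
  by move: h; rewrite -[(e k).+1%:R]natr1; lra.
exists (2 / 9 / 3 ^+ (k0.+1 * L)); first by rewrite divr_gt0 ?pow3_gt0//; lra.
move=> h h0 hlt /andP[xh0 xh1].
have in0 : in_cell k0.+1 (x + h).
  apply/negPn/negP => /far; rewrite addrAC subrr add0r.
  by rewrite leNgt mulrC -ltr_pdivlMr ?pow3_gt0// hlt.
have hgt0 : 0 < `|h| by rewrite normr_gt0.
have [N0 hN0] := pow3_inv_lt hgt0; pose N := maxn N0 k0.+1.
have outN : ~~ in_cell N (x + h).
  have : (3 ^+ (N * L))^-1 < `|h|.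
    by apply: hN0; rewrite (leq_trans (leq_maxl N0 k0.+1))// leq_pmulr.
  rewrite -[X in X < _]mul1r ltr_pdivrMr ?pow3_gt0//.
  rewrite -[X in _ * X](ger0_norm (ltW (pow3_gt0 (N * L)))) -normrM mulrC => h1.
  have /andP[h2 h3] := ex N; apply/negP => /andP[].
  rewrite mulrDr -[(e N).+1%:R]natr1 => h4 h5; move: h1; apply/negP.
  by rewrite -leNgt ler_norml; apply/andP; split; lra.
have exk : exists k, (k0.+1 <= k)%N && ~~ in_cell k (x + h).
  by exists N; rewrite outN andbT leq_maxr.
have [k' /andP[k0k outk] kmin] := ex_minnP exk.
case: k' => [|k] // in k0k outk kmin *.
have {k0k}k0k : (k0.+1 <= k)%N.
  move: k0k; rewrite leq_eqVlt => /predU1P[kE|]//.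
  by move: outk; rewrite -kE in0.
have ink : in_cell k (x + h).
  by apply/negPn/negP => h1; have := kmin k; rewrite k0k h1 ltnn => /(_ isT).
have p3 : 3 ^+ (k * L) != 0 :> R := pow3_neq0 _.
pose t := 3 ^+ (k * L) * x - (e k)%:R.
pose t' := 3 ^+ (k * L) * (x + h) - (e k)%:R.
have t01 : 0 <= t <= 1.
  by have /andP[h1 h2] := ex k; rewrite /t; apply/andP; split; lra.
have t'01 : 0 <= t' <= 1.
  case/andP: ink; rewrite /t' -[(e k).+1%:R]natr1 => h1 h2.
  by apply/andP; split; lra.
have := okamotoK_cellB (eL k) t01 t'01.
have -> : ((e k)%:R + t') / 3 ^+ (k * L) = x + h by rewrite /t'; field.
have -> : ((e k)%:R + t) / 3 ^+ (k * L) = x by rewrite /t; field.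
have -> : t' - t = 3 ^+ (k * L) * h by rewrite /t' /t; ring.
move=> ->; set W := (walk _ _ _)%:~R; set D := _ - _.
have -> : (3 * W * (3 ^+ (k * L) * h) + D) / 3 ^+ (k * L) / h =
    3 * W + D / (3 ^+ (k * L) * h) by field; rewrite h0 p3.
have kW : k%:R <= W by rewrite /W (pmulrn _ k) ler_int.
have k0W : k0.+1%:R <= k%:R :> R by rewrite ler_nat.
have D3 : `|D| <= 3.
  have := okamotoK_bound t01; have := okamotoK_bound t'01; rewrite /D !ler_norml.
  by move=> /andP[? ?] /andP[? ?]; apply/andP; split; lra.
have : `|D / (3 ^+ (k * L) * h)| <= C.
  have p0 : 0 < 3 ^+ (k * L) * `|h| by rewrite mulr_gt0 ?pow3_gt0.
  rewrite normrM normfV normrM (ger0_norm (ltW (pow3_gt0 _))) ler_pdivrMr//.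
  rewrite (le_trans D3)// /C.
  have := far _ _ outk; rewrite mulSn exprD addrAC subrr add0r -mulrA.
  lra.
by rewrite ler_norml => /andP[h1 h2]; lra.
Qed.

End NestedCells.

(** * A large set of points with infinite derivative *)

Section CodedPoints.
Context {R : realType}.
Variable m : nat.
Implicit Types (x y z s : R) (k n : nat).

Lemma cell_div n k y : 0 <= y -> (cell (n + k) y %/ 3 ^ k)%N = cell n y.
Proof.
move=> y0; elim: k => [|k IHk]; first by rewrite addn0 expn0 divn1.
by rewrite addnS expnS divnMA cell_div3.
Qed.

Definition code_cell y k : nat := encode m k (cell (k * m) y).

Lemma code_cellS y k : 0 <= y -> exists2 b,
  (2 * 3 ^ (m + 2) <= b /\ b < 3 ^ (m + 3))%N &
  code_cell y k.+1 = (code_cell y k * 3 ^ (m + 4) + b)%N.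
Proof.
move=> y0; exists (block_code m (cell (k.+1 * m) y %% 3 ^ m)).
  by apply: block_code_bounds; rewrite ltn_mod expn_gt0.
by rewrite /code_cell /= mulSnr cell_div.
Qed.

(** The bounds 2/9 and 1/3 delimit the numbers whose ternary expansion starts
    with 02, as does every code block. *)
Definition code_lower y k : R :=
  ((code_cell y k)%:R + 2 / 9) / 3 ^+ (k * (m + 4)).

Definition code_upper y k : R :=
  ((code_cell y k)%:R + 1 / 3) / 3 ^+ (k * (m + 4)).

Lemma code_lower_upper_step y k : 0 <= y ->
  code_lower y k <= code_lower y k.+1 /\ code_upper y k.+1 <= code_upper y k.
Proof.
move=> y0; have [b [b1 b2] E] := code_cellS k y0.
rewrite /code_lower /code_upper E mulSnr exprD natrD natrM nat3E.
have /andP[h1 h2] : 18 * 3 ^+ m <= (b%:R : R) <= 27 * 3 ^+ m - 1.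
  move: b1 b2; rewrite -(ler_nat R) -(ler_nat R b.+1) -[b.+1%:R]natr1.
  rewrite natrM !nat3E !exprD => b1 b2; apply/andP; split; lra.
have r81 : 3 ^+ (m + 4) = 81 * 3 ^+ m :> R by rewrite exprD; ring.
have q0 : 0 < 3 ^+ m :> R by exact: pow3_gt0.
set c := (code_cell y k)%:R; set p := 3 ^+ (k * _).
have ip0 : 0 < p^-1 by rewrite invr_gt0 pow3_gt0.
have scale Y r : Y / (p * r) = Y / r / p :> R by rewrite invfM mulrA mulrAC.
rewrite !scale r81 !ler_pM2r//.
by split; [rewrite ler_pdivlMr|rewrite ler_pdivrMr]; rewrite ?mulr_gt0//; lra.
Qed.

Lemma code_lower_le_upper y k n : 0 <= y -> code_lower y k <= code_upper y n.
Proof.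
move=> y0.
have lowerD i j : code_lower y i <= code_lower y (i + j).
  elim: j => [|j IHj]; first by rewrite addn0.
  by rewrite (le_trans IHj)// addnS; case: (code_lower_upper_step (i + j) y0).
have upperD i j : code_upper y (i + j) <= code_upper y i.
  elim: j => [|j IHj]; first by rewrite addn0.
  by rewrite (le_trans _ IHj)// addnS; case: (code_lower_upper_step (i + j) y0).
apply: (le_trans (lowerD k n)); apply: (le_trans _ (upperD n k)).
rewrite addnC ler_pM2r ?invr_gt0 ?pow3_gt0//; lra.
Qed.

Definition code_point y : R := sup (range (code_lower y)).

Lemma code_point_itv y k : 0 <= y ->
  code_lower y k <= code_point y <= code_upper y k.
Proof.
move=> y0; apply/andP; split.
  apply: ub_le_sup; last by exists k.
  by exists (code_upper y 0) => _ [n _ <-]; exact: code_lower_le_upper.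
apply: ge_sup; first by exists (code_lower y 0); exists 0%N.
by move=> _ [n _ <-]; exact: code_lower_le_upper.
Qed.

Lemma code_pointE y k : 0 <= y ->
  (code_cell y k)%:R + 2 / 9 <= 3 ^+ (k * (m + 4)) * code_point y <=
  (code_cell y k)%:R + 1 / 3.
Proof.
move=> y0; have := code_point_itv k y0; rewrite /code_lower /code_upper.
rewrite ler_pdivrMr ?pow3_gt0// ler_pdivlMr ?pow3_gt0//.
by rewrite ![code_point y * _]mulrC.
Qed.

Lemma code_point_derivative y : 0 <= y < 1 ->
  infinite_derivative_set (@okamotoK R) (code_point y).
Proof.
move=> /andP[y0 y1]; split.
  have := code_pointE 0 y0; rewrite mul0n expr0 mul1r /code_cell /=.
  by move=> /andP[h1 h2]; apply/andP; split; lra.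
left; apply: (@nested_cells_derivative R (m + 4) (code_cell y)).
- by move=> k; exact: encode_ltn.
- by move=> k; exact: code_pointE.
- by move=> k; exact: walk_encode.
- by rewrite addn4.
Qed.

Lemma code_point_separated y z k : 0 <= y -> 0 <= z ->
  code_cell y k != code_cell z k ->
  (3 ^+ (k * (m + 4)).+1)^-1 <= `|code_point y - code_point z|.
Proof.
wlog yz : y z / (code_cell y k < code_cell z k)%N => [hw y0 z0 ne|y0 z0 _].
  case: (ltngtP (code_cell y k) (code_cell z k)) => [h|h|h].
  - exact: hw.
  - by rewrite distrC; apply: hw => //; rewrite eq_sym.
  - by rewrite h eqxx in ne.
have := code_pointE k y0; have := code_pointE k z0.
move: yz; rewrite -(ler_nat R) -[(code_cell y k).+1%:R]natr1.
set p := 3 ^+ (k * _) => yz /andP[h1 h2] /andP[h3 h4].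
have p0 : 0 < p by exact: pow3_gt0.
rewrite exprS -/p invfM mulrC ler_pdivrMl// distrC.
rewrite (@le_trans _ _ (p * (code_point z - code_point y)))//; first lra.
by rewrite ler_pM2l// ler_norm.
Qed.

(** Points first separated by their k-th block of m digits are at most
    3^(-(k-1)m) apart, whereas their codes are at least 3^(-k(m+4)-1) apart. *)
Lemma code_point_expanding s : (0 < m)%N -> 0 <= s <= 1 ->
  (m + 4)%:R * s <= m%:R -> forall y z, 0 <= y < 1 -> 0 <= z < 1 ->
  `|y - z| <= 3 ^+ m.+1 * `|code_point y - code_point z| `^ s.
Proof.
move=> m0 /andP[s0 s1] ms y z y01 z01.
have [->|yz] := eqVneq y z.
  by rewrite subrr normr0 mulr_ge0 ?powR_ge0// ltW// pow3_gt0.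
have d0 : 0 < `|y - z| by rewrite normr_gt0 subr_eq0.
have /andP[y0 y1] := y01; have /andP[z0 z1] := z01.
have close n : cell n y = cell n z -> `|y - z| < (3 ^+ n)^-1.
  move=> E; have := cell_itv n y0; have := cell_itv n z0; rewrite E.
  rewrite -[(cell n z).+1%:R]natr1 => /andP[h1 h2] /andP[h3 h4].
  rewrite -[ltRHS]mulr1 -ltr_pdivrMl ?invr_gt0 ?pow3_gt0// invrK.
  rewrite -[X in X * _](ger0_norm (ltW (pow3_gt0 n))) -normrM mulrBr.
  by rewrite ltr_norml; apply/andP; split; lra.
have [N hN] := pow3_inv_lt d0.
have exk : exists k, cell (k * m) y != cell (k * m) z.
  exists N; apply/eqP => /close; apply/negP; rewrite -leNgt ltW// hN//.
  by rewrite leq_pmulr.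
have [k kne kmin] := ex_minnP exk.
case: k => [|k] in kne kmin *.
  by move: kne; rewrite mul0n !(@cellP _ _ _ 0%N) ?eqxx// expr0 mul1r.
have {kmin}/close yzk : cell (k * m) y = cell (k * m) z.
  by apply/eqP/negPn/negP => /kmin; rewrite ltnn.
have ne : code_cell y k.+1 != code_cell z k.+1.
  by apply: contra kne => /eqP/encode_inj E; apply/eqP/E; exact: cell_ltn.
have sep := code_point_separated y0 z0 ne.
apply: (le_trans (ltW yzk)).
rewrite mulrC -ler_pdivrMr ?pow3_gt0// -invfM -exprD.
set n := (k.+1 * _).+1 in sep.
apply: (@le_trans _ _ (((3 ^+ n)^-1) `^ s)); last first.
  by apply: ge0_ler_powR; rewrite // nnegrE ?invr_ge0 ?(ltW (pow3_gt0 _)).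
rewrite -!powR_invn// -powRrM; apply: ler_powR; first by rewrite ler1n.
rewrite mulNr lerN2 /n -addn1 natrD natrM.
rewrite (_ : (k * m + m.+1)%N = (k.+1 * m + 1)%N); last by rewrite mulSn; lia.
rewrite [X in _ <= X]natrD [X in _ <= X + _]natrM mulrDl mul1r lerD//.
by rewrite -mulrA ler_wpM2l.
Qed.

End CodedPoints.

Theorem corollary3p2 (R : realType) :
  lebesgue_measure (infinite_derivative_set (@okamotoK R)) = 0%E /\
  hausdorff_dim (infinite_derivative_set (@okamotoK R)) = 1%E.
Proof.
split; first exact: infinite_derivative_null.
apply/eqP; rewrite eq_le; apply/andP; split.
  apply: ereal_inf_lbound; exists 1 => //; split => //.
  exact/hausdorff_measure1_null/infinite_derivative_null.
apply: le_ereal_inf_tmp => _ [s [s0 Hs] <-]; rewrite lee_fin leNgt.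
apply/negP => s1; move: Hs; apply/eqP.
(* so that s <= m / (m + 4) *)
pose m := (Num.truncn (4 * s / (1 - s))).+1.
apply: (@expanding_hausdorff_measure_neq0 _ _ (@code_point R m) s
  (3 ^+ m.+1)) => //.
- exact: code_point_derivative.
- apply: code_point_expanding => //; first by rewrite s0 ltW.
  have := truncnS_gt (4 * s / (1 - s)); rewrite -/m ltr_pdivrMr ?subr_gt0//.
  by rewrite natrD; lra.
Qed.
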